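(* Let $\Lambda$ be a finite box of a $d$-dimensional lattice (for instance $\mathbb{Z}^d$), let $\beta>0$, and consider the random Hamiltonian on spin configurations $\sigma\in\{-1,1\}^\Lambda$ $$H_\Lambda(\sigma)=-\sum_{A\subset\Lambda}J_A\,\sigma_A,\qquad \sigma_A=\prod_{i\in A}\sigma_i,$$ where the $J_A$ are independent centered Gaussian random variables, with translation invariant distribution, and variances $\mathrm{Av}(J_A^2)=\Xi_A^2$, $\Xi_A\ge 0$. Let $\omega_A$ denote the random Boltzmann-Gibbs expectation of $\sigma_A$ at inverse temperature $\beta$ and $\mathrm{Av}$ the expectation over the Gaussian variables. Then for every $A\subset\Lambda$ with $\Xi_A>0$, $$\mathrm{Av}\left(\omega_A^2\right)\;\ge\;1-\frac{1}{\Xi_A\,\beta}\sqrt{\frac{2}{\pi}} .$$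
   Context: For a given realization of the couplings, $\omega_A=\dfrac{\sum_{\sigma}\sigma_A e^{-\beta H_\Lambda(\sigma)}}{\sum_{\sigma}e^{-\beta H_\Lambda(\sigma)}}$, the sums running over $\sigma\in\{-1,1\}^\Lambda$. Translation invariance of the distribution means that $\Xi_A=\Xi_{A'}$ whenever $A'$ is a lattice translate of $A$. A Gaussian variable of variance $0$ is identically $0$. *)

(* Defs.v *)
From HB Require Import structures.
From mathcomp Require Import all_boot all_order all_algebra finmap.
From mathcomp Require Import all_classical all_reals all_analysis.

Set Implicit Arguments.
Unset Strict Implicit.
Unset Printing Implicit Defensive.

Import Order.TTheory GRing.Theory Num.Theory.
Import numFieldNormedType.Exports.

Local Open Scope classical_set_scope.
Local Open Scope ring_scope.

Section Lattice.
Context {R : realType} {d : nat}.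

Definition lattice_point (B : 'M[R]_d) (n : 'rV[int]_d) : 'rV[R]_d :=
  map_mx (fun k : int => k%:~R) n *m B.

(* For B \in unitmx this is the d-dimensional lattice whose Z-basis is the
   rows of B; B = 1%:M gives Z^d. *)
Definition lattice (B : 'M[R]_d) : set 'rV[R]_d := range (lattice_point B).

(* The box has its sides along the basis vectors; a and b are its extreme
   lattice coordinates, both included. *)
Definition is_box (B : 'M[R]_d) (Lambda : {fset 'rV[R]_d}) : Prop :=
  exists a b : 'rV[int]_d, forall x : 'rV[R]_d,
    x \in Lambda <->
    exists2 n : 'rV[int]_d,
      x = lattice_point B n & forall i, a 0 i <= n 0 i <= b 0 i.

(* A' is A shifted by v, as sets of points of R^d. *)
Definition is_translate (Lambda : {fset 'rV[R]_d}) (v : 'rV[R]_d)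
    (A A' : {set Lambda}) : Prop :=
  [fset (val i + v)%R | i in A]%fset = [fset val i | i in A']%fset.

Definition translation_invariant (B : 'M[R]_d) (Lambda : {fset 'rV[R]_d})
    (Xi : {set Lambda} -> R) : Prop :=
  forall (v : 'rV[R]_d) (A A' : {set Lambda}),
    lattice B v -> is_translate v A A' -> Xi A = Xi A'.

End Lattice.

Section SpinSystem.
Context {R : realType} {L : finType}.

(* A configuration in {-1,1}^L is encoded by the Booleans marking the sites
   with spin -1. *)
Definition spin (s : {ffun L -> bool}) (i : L) : R := (-1) ^+ s i.

Definition spin_prod (A : {set L}) (s : {ffun L -> bool}) : R :=
  \prod_(i in A) spin s i.

Definition hamiltonian (J : {set L} -> R) (s : {ffun L -> bool}) : R :=
  - \sum_(A : {set L}) J A * spin_prod A s.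

Definition boltzmann (beta : R) (J : {set L} -> R) (s : {ffun L -> bool}) : R :=
  expR (- beta * hamiltonian J s).

Definition gibbs (beta : R) (J : {set L} -> R) (A : {set L}) : R :=
  (\sum_(s : {ffun L -> bool}) spin_prod A s * boltzmann beta J s) /
  (\sum_(s : {ffun L -> bool}) boltzmann beta J s).

End SpinSystem.

Section RandomVariables.
Context {R : realType} {disp : measure_display} {T : measurableType disp}
  (P : probability T R).

(* X has law N(0, s^2).  The case s = 0 is treated separately because
   normal_prob 0 0 is by convention the uniform law on [0, 1]. *)
Definition centered_gaussian (X : {RV P >-> R}) (s : R) : Prop :=
  forall U : set R, measurable U ->
    distribution P X U = (if s == 0 then \d_(0 : R) U else normal_prob 0 s U).

Definition mutually_independent (I : finType) (X : I -> {RV P >-> R}) : Prop :=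
  forall (K : {set I}) (U : I -> set R), (forall i, measurable (U i)) ->
    P (\bigcap_(i in [set j | j \in K]) (X i @^-1` U i)) =
    (\prod_(i in K) P (X i @^-1` U i))%E.

End RandomVariables.

(* Main.v *)
Require Import Defs.
From HB Require Import structures.
From mathcomp Require Import all_boot all_order all_algebra finmap.
From mathcomp Require Import all_classical all_reals all_analysis.
From mathcomp Require Import measurable_realfun ring lra.

Set Implicit Arguments.
Unset Strict Implicit.
Unset Printing Implicit Defensive.

Import Order.TTheory GRing.Theory Num.Theory.
Import numFieldNormedType.Exports.

Local Open Scope classical_set_scope.
Local Open Scope ring_scope.

(* Freeze all couplings but x = J_A. As a function of x the Gibbs average g of
   sigma_A takes values in [-1, 1] and solves g' = beta (1 - g^2). Hence, phi
   being the density of J_A, (1 - g^2) phi = g' phi / beta, and for x >= 0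
   g' phi <= ((g - 1) phi)' because phi' <= 0; integrating over the half-lines
   [0, +oo[ and, by reflection, ]-oo, 0] bounds the integral of g' phi by
   (1 - g(0)) phi(0) + (1 + g(0)) phi(0) = 2 phi(0) = sqrt(2 / pi) / Xi_A.
   The other couplings enter g only through a ratio of two partition functions
   independent of J_A, so the bound on 1 - g^2 survives averaging over them. *)

(** * Gaussian integrals of solutions of the equation g' = beta (1 - g^2) *)

Section GaussianDensity.
Context {R : realType}.
Notation mu := (@lebesgue_measure R).
Implicit Types (s beta x : R) (g : R -> R).

(** The density agrees almost everywhere with the Radon-Nikodym derivative, both having the same
    integral over every measurable set. The bound [M] makes [f] integrable for the probability
    measure, as the change of variables requires. *)
Lemma ge0_integral_normal_prob m s (f : R -> R) (M : R) :
  measurable_fun setT f -> (forall x, 0 <= f x <= M) ->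
  (\int[normal_prob m s]_x (f x)%:E =
   \int[mu]_x (f x * normal_pdf m s x)%:E)%E.
Proof.
move=> mf f0; have dom := normal_prob_dominates m s.
under [RHS]eq_integral do rewrite EFinM.
rewrite -(Radon_Nikodym_change_of_variables dom)//=; last first.
  apply/integrableP; split; first exact/measurable_EFinP.
  apply: (@le_lt_trans _ _ (\int[normal_prob m s]_x (cst M%:E x))%E).
    apply: ge0_le_integral => //=.
    - by do 2 apply: measurableT_comp => //.
    - by move=> x _; have /andP[fx0 fxM] := f0 x; rewrite ger0_norm// lee_fin.
  by rewrite integral_cst//= probability_setT mule1 ltry.
apply: ae_eq_integral => //.
- apply: emeasurable_funM; first exact/measurable_EFinP.
  apply: (measurable_int mu).
  by apply: Radon_Nikodym_integrable; exact: dom.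
- apply: emeasurable_funM; apply/measurable_EFinP => //.
  exact: measurable_normal_pdf.
- apply: ae_eqe_mul2l => /=.
  rewrite Radon_NikodymE//=.
  case: cid => /= h [h1 h2 h3].
  apply: integral_ae_eq => //=.
  + by apply/measurable_EFinP; exact: measurable_normal_pdf.
  + by move=> E E01 mE; rewrite -h3.
Qed.

Lemma is_derive_normal_pdf0 s x : s != 0 ->
  is_derive x 1 (normal_pdf 0 s) (- (x / s ^+ 2) * normal_pdf 0 s x).
Proof.
move=> s0; rewrite normal_pdfE//.
rewrite (_ : (fun _ => _) = fun x =>
  normal_peak s * expR (- (x ^+ 2) / (s ^+ 2 *+ 2))); last first.
  by apply/funext => y; rewrite /normal_fun subr0.
apply: is_derive_eq; rewrite /normal_fun subr0 /GRing.scale/=.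
by field.
Qed.

Lemma normal_pdf0_cvgy s : s != 0 -> normal_pdf 0 s x @[x --> +oo] --> (0 : R).
Proof.
move=> s0; rewrite normal_pdfE//.
rewrite [X in _ --> X](_ : _ = normal_peak s * 0); last by rewrite mulr0.
apply: cvgM; first exact: cvg_cst.
rewrite /normal_fun.
under eq_fun do rewrite subr0 mulNr.
apply: (@cvg_comp _ _ _ (fun x : R => x ^+ 2 / (s ^+ 2 *+ 2))
  (fun y => expR (- y)) _ (pinfty_nbhs R)); last exact: cvgr_expR.
apply/gt0_cvgMly; last exact: cvgr_expr2.
by rewrite invr_gt0 pmulrn_lgt0// exprn_even_gt0.
Qed.

Lemma integral_tanh_ode_half beta s g : 0 < beta -> 0 < s ->
  (forall x : R, is_derive x 1 g (beta * (1 - g x ^+ 2))) ->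
  (forall x, -1 <= g x <= 1) ->
  (\int[mu]_(x in `[0%R, +oo[) (beta * (1 - g x ^+ 2) * normal_pdf 0 s x)%:E
    <= ((1 - g 0) * normal_pdf 0 s 0)%:E)%E.
Proof.
move=> b0 s0 dg g1; have sn0 : s != 0 by rewrite gt_eqF.
pose phi := normal_pdf 0 s.
have phi0 x : 0 <= phi x by exact: normal_pdf_ge0.
have cg : continuous g.
  by move=> x; apply/differentiable_continuous/derivable1_diffP; have [] := dg x.
have cphi : continuous phi by exact: continuous_normal_pdf.
(* Subtracting 1 makes the factor of phi' nonpositive, so the second summand of F' = [f] is
   nonnegative for x >= 0. As [F] vanishes at +oo, [f] integrates to - F(0) over the half-line. *)
pose F x := (g x - 1) * phi x.
pose f x := beta * (1 - g x ^+ 2) * phi x + (1 - g x) * (x / s ^+ 2 * phi x).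
have dphi x := is_derive_normal_pdf0 x sn0.
have dF x : is_derive x 1 F (f x).
  rewrite /F; apply: is_derive_eq.
  by rewrite /f /GRing.scale/= -/phi; ring.
have h0 x : 0 <= beta * (1 - g x ^+ 2) * phi x.
  apply: mulr_ge0 => //; apply: mulr_ge0; first exact: ltW.
  by rewrite subr_ge0; have /andP[? ?] := g1 x; nra.
have k0 x : 0 <= x -> 0 <= (1 - g x) * (x / s ^+ 2 * phi x).
  move=> x0; rewrite mulr_ge0//; first by rewrite subr_ge0; have /andP[] := g1 x.
  by rewrite mulr_ge0// divr_ge0// sqr_ge0.
have ch : continuous (fun x => beta * (1 - g x ^+ 2) * phi x).
  move=> x; apply: cvgM; last exact: cphi.
  apply: cvgM; first exact: cvg_cst.
  by apply: cvgB; [exact: cvg_cst|apply: cvgM; exact: cg].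
have ck : continuous (fun x => (1 - g x) * (x / s ^+ 2 * phi x)).
  move=> x; apply: cvgM; first by apply: cvgB; [exact: cvg_cst|exact: cg].
  apply: cvgM; last exact: cphi.
  by apply: cvgM; [exact: cvg_id|exact: cvg_cst].
have cf : continuous f by move=> x; apply: cvgD; [exact: ch|exact: ck].
apply: (@le_trans _ _ (\int[mu]_(x in `[0%R, +oo[) (f x)%:E)%E).
  apply: ge0_le_integral => //=.
  - by move=> x _; rewrite lee_fin.
  - apply/measurable_EFinP; apply: measurable_funTS.
    exact: continuous_measurable_fun.
  - apply/measurable_EFinP; apply: measurable_funTS.
    exact: continuous_measurable_fun.
  - by move=> x; rewrite in_itv/= andbT => x0; rewrite lee_fin lerDl k0.
rewrite (@ge0_continuous_FTC2y _ f F 0 0).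
- by rewrite -EFinB lee_fin sub0r /F -mulNr opprB.
- by move=> x x0; rewrite addr_ge0// k0.
- exact: continuous_subspaceT.
- apply/norm_cvg0P.
  apply: (@squeeze_cvgr _ _ _ _ (cst 0) (fun x => 2 * phi x)).
  + near=> x; rewrite /F normr_ge0 normrM (ger0_norm (phi0 _))/= ler_wpM2r//.
    by have /andP[] := g1 x; rewrite ler_norml; lra.
  + exact: cvg_cst.
  + rewrite [X in _ --> X](_ : _ = 2 * 0 :> R); last by rewrite mulr0.
    by apply: cvgM; [exact: cvg_cst|exact: normal_pdf0_cvgy].
- by move=> x _; have [] := dF x.
- apply: cvg_at_right_filter.
  by apply/differentiable_continuous/derivable1_diffP; have [] := dF 0.
- by move=> x _; rewrite derive1E; have [_ ->] := dF x.
Unshelve. all: by end_near.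
Qed.

(* The solutions of g' = beta (1 - g^2) are the translates of
   x |-> tanh (beta x), together with the constants 1 and -1. *)
Lemma normal_prob_tanh_ode beta s g : 0 < beta -> 0 < s ->
  (forall x : R, is_derive x 1 g (beta * (1 - g x ^+ 2))) ->
  (forall x, -1 <= g x <= 1) ->
  (\int[normal_prob 0 s]_x (1 - g x ^+ 2)%:E
    <= (1 / (s * beta) * Num.sqrt (2 / pi))%:E)%E.
Proof.
move=> b0 s0 dg g1; have sn0 : s != 0 by rewrite gt_eqF.
have cg : continuous g.
  by move=> x; apply/differentiable_continuous/derivable1_diffP; have [] := dg x.
have g01 x : 0 <= 1 - g x ^+ 2 <= 1.
  by rewrite gerBl sqr_ge0 andbT subr_ge0; have /andP[? ?] := g1 x; nra.
have mg : measurable_fun setT (fun x => 1 - g x ^+ 2).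
  apply: measurable_funB => //; apply: measurable_funX.
  exact: continuous_measurable_fun.
rewrite (ge0_integral_normal_prob 0 s mg g01).
pose h x := beta * (1 - g x ^+ 2) * normal_pdf 0 s x.
have h0 x : 0 <= h x.
  apply: mulr_ge0; last exact: normal_pdf_ge0.
  by apply: mulr_ge0; [exact: ltW|have /andP[] := g01 x].
have ch : continuous h.
  move=> x; apply: cvgM; last exact: continuous_normal_pdf.
  apply: cvgM; first exact: cvg_cst.
  by apply: cvgB; [exact: cvg_cst|apply: cvgM; exact: cg].
have mh D : measurable_fun D (EFin \o h).
  apply/measurable_EFinP; apply: measurable_funTS.
  exact: continuous_measurable_fun.
have hneg : (\int[mu]_(x in `]-oo, 0%R[) (h x)%:E
    <= ((1 + g 0) * normal_pdf 0 s 0)%:E)%E.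
  (* The half-line is closed and its endpoint written - 0 to fit the substitution x |-> - x. *)
  apply: (@le_trans _ _ (\int[mu]_(x in `]-oo, (- 0)%R]) (h x)%:E)%E).
    apply: ge0_subset_integral => //=.
    - exact: mh.
    - by move=> x _; rewrite lee_fin.
    - by rewrite oppr0; apply: subset_itvl; rewrite bnd_simp.
  rewrite ge0_integration_by_substitutionNy; last 2 first.
  - exact: continuous_subspaceT.
  - by move=> x _; exact: h0.
  (* The function x |-> - g(- x) solves the same equation within the same bounds, and its value -
     g(0) at 0 turns 1 - g(0) into 1 + g(0). *)
  have := @integral_tanh_ode_half beta s (fun x => - g (- x)) b0 s0.
  rewrite /= oppr0 opprK => half.
  have hN x : h (- x) = beta * (1 - (- g (- x)) ^+ 2) * normal_pdf 0 s x.
    by rewrite /h /= sqrrN normal_pdfE// /normal_fun !subr0 sqrrN.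
  under eq_integral do rewrite /= hN.
  apply: half => x; last by have /andP[? ?] := g1 (- x); lra.
  have dgN := is_deriveN (is_derive1_comp (dg (- x))
    (is_deriveN (is_derive_id x (1 : R)))).
  by apply: (is_derive_eq dgN); rewrite sqrrN mulrN1 opprK.
have hle : (\int[mu]_x (h x)%:E <= (2 * normal_pdf 0 s 0)%:E)%E.
  rewrite -(setUv `[0%R, +oo[%classic) setUC setCitvr.
  rewrite ge0_integral_setU//=; last 3 first.
  - exact: mh.
  - by move=> x _; rewrite lee_fin.
  - by rewrite -setCitvr disj_set2E setICl.
  have -> : 2 * normal_pdf 0 s 0 = (1 + g 0) * normal_pdf 0 s 0
      + (1 - g 0) * normal_pdf 0 s 0 by ring.
  by rewrite EFinD; apply: leeD => //; exact: integral_tanh_ode_half.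
rewrite -(@lee_pmul2l _ beta%:E)// -ge0_integralZl//=; last 3 first.
- apply/measurable_EFinP; apply: measurable_funM => //.
  exact: measurable_normal_pdf.
- move=> x _; rewrite lee_fin; apply: mulr_ge0; last exact: normal_pdf_ge0.
  by have /andP[] := g01 x.
- by rewrite lee_fin ltW.
under eq_integral do rewrite -EFinM mulrA.
apply: (le_trans hle); rewrite -EFinM lee_fin.
rewrite normal_pdfE// /normal_peak /normal_fun subr0 expr0n/= oppr0 mul0r expR0.
rewrite mulr1.
have p0 : 0 < pi :> R by exact: pi_gt0.
have q0 : Num.sqrt (pi *+ 2 : R) != 0.
  by rewrite gt_eqF// sqrtr_gt0 pmulrn_lgt0.
(* Substituted for the numerator of 2 phi(0) = 2 / (s sqrt(2 pi)), this product leaves sqrt(2 / pi)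
   / s. *)
have sqrtE : Num.sqrt (2 / pi) * Num.sqrt (pi *+ 2) = 2 :> R.
  rewrite -sqrtrM; last by rewrite divr_ge0// ltW.
  have -> : 2 / pi * (pi *+ 2) = 2 ^+ 2 :> R.
    by rewrite -(mulr_natr pi) mulrA divfK ?expr2// gt_eqF.
  by rewrite sqrtr_sqr ger0_norm.
rewrite -mulrnAr sqrtrM ?sqr_ge0// sqrtr_sqr gtr0_norm// -{1}sqrtE.
rewrite le_eqVlt; apply/predU1P; left; field.
by rewrite sn0 q0 gt_eqF.
Qed.

End GaussianDensity.

(** * Independence of one variable from the sigma-algebra of the others *)

Section Independence.
Context {R : realType} {disp : measure_display} {T : measurableType disp}
  (P : probability T R).

(** A pi-system generating the sigma-algebra of the variables with index in [K]. *)
Definition cylinders (I : finType) (X : I -> {RV P >-> R}) (K : {set I}) :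
    set (set T) :=
  [set V | exists2 U : I -> set R, (forall i, measurable (U i)) &
    V = \bigcap_(i in [set j | j \in K]) (X i @^-1` U i)].

Lemma cylinders_setI (I : finType) (X : I -> {RV P >-> R}) (K : {set I}) :
  setI_closed (cylinders X K).
Proof.
move=> _ _ [U mU ->] [V mV ->]; exists (fun i => U i `&` V i).
  by move=> i; exact: measurableI.
by rewrite -bigcapI.
Qed.

Lemma cylinders_setT (I : finType) (X : I -> {RV P >-> R}) (K : {set I}) :
  cylinders X K setT.
Proof.
by exists (fun=> setT) => //; rewrite bigcapT.
Qed.

Lemma cylinders_measurable (I : finType) (X : I -> {RV P >-> R})
  (K : {set I}) : cylinders X K `<=` measurable.
Proof.
move=> _ [U mU ->]; apply: fin_bigcap_measurable => // i _.
by rewrite -[X in measurable X]setTI; exact: measurable_funP.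
Qed.

Lemma cylinders_measurable_fun (I : finType) (X : I -> {RV P >-> R})
    (K : {set I}) (i : I) : i \in K ->
  measurable_fun setT (X i : g_sigma_algebraType (cylinders X K) -> R).
Proof.
move=> iK _ U mU; rewrite setTI; apply: sub_sigma_algebra.
exists (fun j => if j == i then U else setT).
  by move=> j; case: ifP.
apply/seteqP; split => t /=.
  by move=> Ut j _; case: eqP => // ->.
by move=> /(_ i iK) /=; rewrite eqxx.
Qed.

(** As functions of [V] both sides are finite measures. They agree on the cylinders, a pi-system,
    hence on the sigma-algebra it generates. *)
Lemma independent_complement (I : finType) (X : I -> {RV P >-> R}) (i : I)
    (U : set R) (V : set T) : mutually_independent X -> measurable U ->
  <<s cylinders X [set~ i] >> V ->
  P ((X i @^-1` U) `&` V) = (P (X i @^-1` U) * P V)%E.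
Proof.
move=> indep mU.
have mXU : measurable (X i @^-1` U).
  by rewrite -[X in measurable X]setTI; exact: measurable_funP.
have pge0 : 0 <= fine (P (X i @^-1` U)) by exact: fine_ge0.
pose m1 := mrestr P mXU.
pose m2 := mscale (NngNum pge0) P.
have pE : (fine (P (X i @^-1` U)))%:E = P (X i @^-1` U).
  by rewrite fineK// fin_num_measure.
have m2E W : m2 W = (P (X i @^-1` U) * P W)%E by rewrite -[in RHS]pE.
move=> sV; rewrite setIC -[LHS]/(m1 V) -m2E.
apply: (@g_sigma_algebra_measure_unique _ _ _ (cylinders X [set~ i]) _
  (fun=> setT)) => //.
- exact: cylinders_measurable.
- by move=> ?; exact: cylinders_setT.
- by rewrite bigcup_const.
- exact: cylinders_setI.
- move=> _ [W mW ->]; rewrite -[RHS]/(m2 _) m2E /m1 /mrestr.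
  (* The intersection is the cylinder of [W'] over all indices; independence is used for it and for
     the cylinder of [W] over the indices other than [i]. *)
  pose W' j := if j == i then U else W j.
  have mW' j : measurable (W' j) by rewrite /W'; case: ifP.
  have W'i : W' i = U by rewrite /W' eqxx.
  have W'E j : j \in [set~ i]%SET -> W' j = W j.
    by rewrite !inE /W' => /negbTE ->.
  have := indep finset.setT W' mW'; rewrite (big_setD1 i) ?inE//=.
  have -> : (finset.setTfor I :\ i)%SET = [set~ i]%SET.
    by apply/setP => j; rewrite !inE andbT.
  under eq_bigr => j ji do rewrite W'E//.
  rewrite -(indep [set~ i]%SET W mW) W'i => <-; congr (P _).
  apply/seteqP; split => t /=.
    move=> [Wt Ut] j _ /=; have [->|ji] := eqVneq j i; first by rewrite W'i.
    by rewrite W'E ?inE//; apply: Wt; rewrite /= !inE.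
  move=> Wt; split; last by have := Wt i; rewrite /= inE W'i; exact.
  by move=> j /= ji; have := Wt j; rewrite /= inE W'E//; exact.
- move=> _; rewrite -[ltLHS]/(P (setT `&` X i @^-1` U)) setTI.
  by rewrite -ge0_fin_numE// fin_num_measure.
Qed.

(* Measurability of Y for the sigma-algebra of the cylinders says that Y is a
   function of the variables other than X i. *)
Lemma expectation_freeze (I : finType) (X : I -> {RV P >-> R}) (i : I)
    (Y : {RV P >-> R}) (f : R * R -> \bar R) : mutually_independent X ->
  measurable_fun setT (Y : g_sigma_algebraType (cylinders X [set~ i]) -> R) ->
  measurable_fun setT f -> (forall z, 0 <= f z)%E ->
  (\int[P]_t f (X i t, Y t) =
   \int[distribution P Y]_y \int[distribution P (X i)]_x f (x, y))%E.
Proof.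
move=> indep mY mf f0.
have mXY : measurable_fun setT (fun t => (X i t, Y t)).
  exact: measurable_fun_pair.
transitivity (\int[pushforward P (fun t => (X i t, Y t))]_z f z)%E.
  by rewrite ge0_integral_pushforward// => z _.
rewrite -fubini_tonelli// -fubini_tonelli1//.
(* The joint law is the product of the two laws as soon as they agree on rectangles, where
   independence applies. *)
apply: eq_measure_integral => A mA _.
apply/esym; apply: product_measure_unique => // U V mU mV.
rewrite /= /distribution /pushforward /= -(independent_complement indep)//.
by have := mY measurableT V mV; rewrite setTI.
Qed.

(* The Borel sigma-algebra of R comes with two structures, that of R used by
   distribution and measurableTypeR R used by normal_prob; the identity map
   transfers integrals between them. *)
Lemma ge0_integral_centered_gaussian (X : {RV P >-> R}) (s : R)
    (f : R -> \bar R) : s != 0 -> centered_gaussian X s ->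
  measurable_fun setT f -> (forall x, 0 <= f x)%E ->
  (\int[distribution P X]_x f x = \int[normal_prob 0 s]_x f x)%E.
Proof.
move=> s0 hX mf f0; pose id0 : measurableTypeR R -> R := idfun.
have mid : measurable_fun setT id0 by exact: (@measurable_id _ _ setT).
pose idR : {mfun measurableTypeR R >-> R} :=
  HB.pack id0 (isMeasurableFun.Build _ _ _ _ id0 mid).
transitivity (\int[distribution (normal_prob 0 s) idR]_x f x)%E.
  by apply: eq_measure_integral => U mU _; rewrite [LHS]hX// (negbTE s0).
by rewrite ge0_integral_distribution.
Qed.

End Independence.

(** * The Gibbs average as a function of one coupling *)

Section GibbsInOneCoupling.
Context {R : realType}.
Implicit Types (beta x y : R).

(* The Gibbs average of spin_prod A as a function of x = J_A, where y is the
   ratio of the Boltzmann weights, with the factors exp(+-beta x) removed, of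
   {sigma_A = -1} and {sigma_A = 1}. The absolute value only serves to make
   the denominator positive for every real y. *)
Definition gibbs_ratio beta x y : R :=
  (expR (beta * x) - expR (- (beta * x)) * `|y|) /
  (expR (beta * x) + expR (- (beta * x)) * `|y|).

Lemma gibbs_ratio_den_gt0 beta x y :
  0 < expR (beta * x) + expR (- (beta * x)) * `|y|.
Proof. by rewrite ltr_wpDr ?expR_gt0// mulr_ge0// expR_ge0. Qed.

Lemma gibbs_ratio_bounded beta x y : -1 <= gibbs_ratio beta x y <= 1.
Proof.
have D0 := gibbs_ratio_den_gt0 beta x y.
rewrite /gibbs_ratio ler_pdivlMr// ler_pdivrMr// mulN1r mul1r.
have := expR_gt0 (beta * x).
have : 0 <= expR (- (beta * x)) * `|y| by rewrite mulr_ge0// expR_ge0.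
by move=> ? ?; apply/andP; split; lra.
Qed.

(** The numerator N and the denominator D satisfy N' = beta D and D' = beta N, so (N / D)' = beta (1
    - (N / D)^2). *)
Lemma is_derive_gibbs_ratio beta y x :
  is_derive x 1 (gibbs_ratio beta ^~ y)
    (beta * (1 - gibbs_ratio beta x y ^+ 2)).
Proof.
have D0 := gibbs_ratio_den_gt0 beta x y.
pose N z := expR (beta * z) - expR (- (beta * z)) * `|y|.
pose D z := expR (beta * z) + expR (- (beta * z)) * `|y|.
have D0' : D x != 0 by rewrite gt_eqF.
have de : is_derive x 1 (fun z => expR (beta * z)) (beta * expR (beta * x)).
  by apply: is_derive_eq; rewrite /GRing.scale/=; ring.
have dn : is_derive x 1 (fun z => expR (- (beta * z)))
    (- beta * expR (- (beta * x))).
  by apply: is_derive_eq; rewrite /GRing.scale/=; ring.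
have dN : is_derive x 1 N (beta * D x).
  by rewrite /N; apply: is_derive_eq; rewrite /D /GRing.scale/=; ring.
have dD : is_derive x 1 D (beta * N x).
  by rewrite /D; apply: is_derive_eq; rewrite /N /GRing.scale/=; ring.
rewrite (_ : gibbs_ratio beta ^~ y = fun z => N z * (D z)^-1)//.
have dV := is_deriveV D0'.
apply: is_derive_eq; rewrite /GRing.scale/= -/(N x) -/(D x) /gibbs_ratio.
rewrite -/(N x) -/(D x).
by field.
Qed.

(** On positive reals the inverse is exp(- ln), a composition of measurable functions. *)
Lemma measurable_inv_gt0 {d} {T : measurableType d} (f : T -> R) :
  measurable_fun setT f -> (forall t, 0 < f t) ->
  measurable_fun setT (fun t => (f t)^-1).
Proof.
move=> mf f0; rewrite (_ : (fun _ => _) = fun t => expR (- ln (f t))).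
  apply: measurableT_comp; first exact: measurable_expR.
  by do 2 apply: measurableT_comp => //; exact: measurable_ln.
by apply/funext => t; rewrite -lnV ?posrE ?f0// lnK// posrE invr_gt0.
Qed.

Lemma measurable_gibbs_ratio beta :
  measurable_fun setT (fun z : R * R => gibbs_ratio beta z.1 z.2).
Proof.
have me : measurable_fun setT (fun z : R * R => expR (beta * z.1)).
  by apply: measurableT_comp => //; apply: measurable_funM.
have mn : measurable_fun setT
    (fun z : R * R => expR (- (beta * z.1)) * `|z.2|).
  apply: measurable_funM; last exact: measurableT_comp.
  by do 2 apply: measurableT_comp => //; apply: measurable_funM.
apply: measurable_funM; first exact: measurable_funB.
apply: measurable_inv_gt0 => [|z]; first exact: measurable_funD.
exact: gibbs_ratio_den_gt0.
Qed.

Context {L : finType}.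
Implicit Types (J : {set L} -> R) (A : {set L}) (s : {ffun L -> bool}).

Lemma spin_prod_pm1 A s :
  spin_prod A s = (if spin_prod A s == 1 :> R then 1 else -1) :> R.
Proof.
suff: (spin_prod A s == 1 :> R) || (spin_prod A s == -1 :> R).
  by case: eqP => //= _ /eqP.
rewrite /spin_prod; apply: (big_ind (fun u : R => (u == 1) || (u == -1))).
- by rewrite eqxx.
- by move=> u v /orP[]/eqP-> /orP[]/eqP->;
    rewrite ?mul1r ?mulr1 ?mulN1r ?opprK eqxx ?orbT.
- by move=> i _; rewrite /spin; case: (s i); rewrite ?expr1 ?expr0 eqxx ?orbT.
Qed.

Definition weight_off beta J A s : R :=
  expR (beta * \sum_(A' : {set L} | A' != A) J A' * spin_prod A' s).

Definition partition_off beta J A (up : bool) : R :=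
  \sum_(s : {ffun L -> bool} | (spin_prod A s == 1 :> R) == up)
    weight_off beta J A s.

Lemma partition_off_ge0 beta J A up : 0 <= partition_off beta J A up.
Proof. by apply: sumr_ge0 => s _; exact: expR_ge0. Qed.

(** The configuration with all spins 1 has sigma_A = 1. The sum over sigma_A = -1 is empty when [A]
    is, so only this one can serve as a denominator. *)
Lemma partition_off_true_gt0 beta J A : 0 < partition_off beta J A true.
Proof.
rewrite /partition_off (bigD1 [ffun=> false])/=.
  by rewrite ltr_pwDl ?expR_gt0// sumr_ge0// => s _; exact: expR_ge0.
rewrite eqb_id /spin_prod big1// => i _.
by rewrite /spin ffunE expr0.
Qed.

Lemma boltzmannE beta J A s : boltzmann beta J s =
  expR (beta * J A * spin_prod A s) * weight_off beta J A s.
Proof.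
rewrite /boltzmann /hamiltonian /weight_off -expRD (bigD1 A)//=.
by congr expR; ring.
Qed.

(** Configurations are grouped by the value of sigma_A, which fixes the factor exp(beta J_A
    sigma_A); numerator and denominator are then divided by the partition function of sigma_A =
    1. *)
Lemma gibbsE beta J A : gibbs beta J A = gibbs_ratio beta (J A)
  (partition_off beta J A false / partition_off beta J A true).
Proof.
have p0 := partition_off_true_gt0 beta J A.
have sumE (h : R -> R) : \sum_(s : {ffun L -> bool})
    h (spin_prod A s) * weight_off beta J A s =
    h 1 * partition_off beta J A true + h (-1) * partition_off beta J A false.
  rewrite (bigID (fun s => spin_prod A s == 1 :> R))/= /partition_off !big_distrr/=.
  congr (_ + _); apply: eq_big => s; rewrite ?eqb_id ?eqbF_neg//.
  + by move/eqP => ->.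
  + by move=> /negbTE sA; have := spin_prod_pm1 A s; rewrite sA => ->.
rewrite /gibbs_ratio ger0_norm; last first.
  by rewrite divr_ge0// ?partition_off_ge0.
rewrite /gibbs; under eq_bigr do rewrite (boltzmannE beta J A) mulrA.
under [X in _ / X]eq_bigr do rewrite (boltzmannE beta J A).
rewrite (sumE (fun u => u * expR (beta * J A * u))).
rewrite (sumE (fun u => expR (beta * J A * u))) !mulr1 !mulrN1 mul1r.
have pn0 : partition_off beta J A true != 0 by rewrite gt_eqF.
have D0 : 0 < expR (beta * J A) * partition_off beta J A true +
    expR (- (beta * J A)) * partition_off beta J A false.
  by rewrite ltr_wpDr ?mulr_gt0 ?expR_gt0// mulr_ge0 ?expR_ge0 ?partition_off_ge0.
have Dn0 := lt0r_neq0 D0.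
field; rewrite Dn0 pn0 /=.
by [].
Qed.

Lemma measurable_partition_off {d} {T : measurableType d} beta
    (J : {set L} -> T -> R) A up :
  (forall A', A' != A -> measurable_fun setT (J A')) ->
  measurable_fun setT (fun t => partition_off beta (J ^~ t) A up).
Proof.
move=> mJ; rewrite /partition_off.
under eq_fun do rewrite big_mkcond/=.
apply: measurable_sum => s; case: (_ == up) => //.
apply: measurableT_comp; first exact: measurable_expR.
apply: measurable_funM => //.
under eq_fun do rewrite big_mkcond/=.
apply: measurable_sum => A'; case AA': (A' != A) => //.
by apply: measurable_funM => //; exact: mJ.
Qed.

(** Since [T] is arbitrary, this also covers the sigma-algebra generated by the couplings other than
    J_A. *)
Lemma measurable_partition_off_ratio {d} {T : measurableType d} beta
    (J : {set L} -> T -> R) A :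
  (forall A', A' != A -> measurable_fun setT (J A')) ->
  measurable_fun setT (fun t => partition_off beta (J ^~ t) A false /
    partition_off beta (J ^~ t) A true).
Proof.
move=> mJ; apply: measurable_funM; first exact: measurable_partition_off.
apply: measurable_inv_gt0; first exact: measurable_partition_off.
by move=> t; exact: partition_off_true_gt0.
Qed.

End GibbsInOneCoupling.

(** * Averaging over all couplings *)

Theorem mainTheorem3 (R : realType) (d : nat)
    (B : 'M[R]_d) (hB : B \in unitmx)
    (Lambda : {fset 'rV[R]_d}) (hLambda : is_box B Lambda)
    (beta : R) (hbeta : 0 < beta)
    (disp : measure_display) (T : measurableType disp) (P : probability T R)
    (Xi : {set Lambda} -> R) (J : {set Lambda} -> {RV P >-> R})
    (hXi : forall A : {set Lambda}, 0 <= Xi A)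
    (hinv : translation_invariant B Xi)
    (hgauss : forall A : {set Lambda}, centered_gaussian (J A) (Xi A))
    (hindep : mutually_independent J)
    (A : {set Lambda}) (hA : 0 < Xi A) :
  ((1 - 1 / (Xi A * beta) * Num.sqrt (2 / pi))%:E
     <= 'E_P[fun t => (gibbs beta (fun A' => J A' t) A ^+ 2)%R])%E.
Proof.
set K := 1 / (Xi A * beta) * Num.sqrt (2 / pi).
pose Y0 t := partition_off beta (J ^~ t) A false /
  partition_off beta (J ^~ t) A true.
have mY0 : measurable_fun setT Y0.
  exact: (@measurable_partition_off_ratio _ _ _ _ beta (fun A' t => J A' t)).
pose Y : {RV P >-> R} := HB.pack Y0 (isMeasurableFun.Build _ _ _ _ Y0 mY0).
have mYG : measurable_fun setT
    (Y : g_sigma_algebraType (cylinders J [set~ A]) -> R).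
  apply: (@measurable_partition_off_ratio _ _ _
    (g_sigma_algebraType (cylinders J [set~ A])) beta (fun A' t => J A' t)) => A' AA'.
  by apply: cylinders_measurable_fun; rewrite !inE.
pose f (z : R * R) := (1 - gibbs_ratio beta z.1 z.2 ^+ 2)%:E.
have f0 z : (0 <= f z)%E.
  rewrite lee_fin subr_ge0.
  by have /andP[? ?] := gibbs_ratio_bounded beta z.1 z.2; nra.
have mf : measurable_fun setT f.
  apply/measurable_EFinP; apply: measurable_funB => //.
  by apply: measurable_funX; exact: measurable_gibbs_ratio.
(* The bound is uniform in [y], so it survives integration against the law of [Y], a probability. *)
have inner y : (\int[distribution P (J A)]_x f (x, y) <= K%:E)%E.
  rewrite (ge0_integral_centered_gaussian (lt0r_neq0 hA) (hgauss A))//.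
    exact: normal_prob_tanh_ode hbeta hA (is_derive_gibbs_ratio beta y)
      (gibbs_ratio_bounded beta ^~ y).
  exact: measurableT_comp mf (pair2_measurable y).
have Ef : (\int[P]_t f (J A t, Y t) <= K%:E)%E.
  rewrite (expectation_freeze hindep mYG mf f0).
  apply: (@le_trans _ _ (\int[distribution P Y]_y (cst K%:E y))%E).
    apply: ge0_le_integral => //=.
    - by move=> y _; exact: integral_ge0.
    - exact: (measurable_fun_fubini_tonelli_G (m1 := distribution P (J A)) f).
  by rewrite integral_cst//= probability_setT mule1.
have mJY : measurable_fun setT (fun t => (J A t, Y t)).
  exact: measurable_fun_pair.
rewrite unlock.
under eq_integral do rewrite gibbsE.
rewrite EFinB leeBlDr//.
(* Writing 1 as the integral of g^2 + (1 - g^2), two nonnegative terms, avoids subtracting extended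
   real integrals. *)
have <- : (\int[P]_t ((gibbs_ratio beta (J A t) (Y t) ^+ 2)%:E
    + f (J A t, Y t)) = 1)%E.
  transitivity (\int[P]_t (cst 1%:E t))%E.
    by apply: eq_integral => t _; rewrite -EFinD subrKC.
  by rewrite integral_cst//= probability_setT mule1.
rewrite ge0_integralD//=; first exact: leeD2l.
- by move=> t _; rewrite lee_fin sqr_ge0.
- apply/measurable_EFinP; apply: measurable_funX.
  exact: (measurableT_comp (measurable_gibbs_ratio beta) mJY).
- exact: (measurableT_comp mf mJY).
Qed.
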